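(* Let $A$ be a commutative ring with unit whose elements are enumerated as $x_0, x_1, x_2, \ldots$ (a surjection $\mathbb{N} \to A$, $n \mapsto x_n$). Define ideals $\mathfrak{m}_n \subseteq A$ recursively by $\mathfrak{m}_0 := \{0\}$ and $\mathfrak{m}_{n+1} := \mathfrak{m}_n + (\{x_n \mid 1 \notin \mathfrak{m}_n + (x_n)\})$, and set $\mathfrak{m} := \bigcup_{n} \mathfrak{m}_n$. Then: (a) The ideal $\mathfrak{m}$ is maximal in the sense that it is proper ($1 \notin \mathfrak{m}$) and that for all elements $x \in A$, if $1 \notin \mathfrak{m} + (x)$, then $x \in \mathfrak{m}$. (b) The ideal $\mathfrak{m}$ is prime in the sense that it is proper and that for all elements $x, y \in A$, if $xy \in \mathfrak{m}$ and $x \notin \mathfrak{m}$, then $y \in \mathfrak{m}$. (c) The ideal $\mathfrak{m}$ is radical in the sense that for every $k \geq 0$ and every $x \in A$, if $x^k \in \mathfrak{m}$, then $x \in \mathfrak{m}$.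
   Context: The metatheory is constructive (minimal logic; no law of excluded middle and no form of the axiom of choice). The negation ``not $\varphi$'' means ``$\varphi \Rightarrow 1 = 0$ in $A$''; consequently $x \notin M$ means $x \in M \Rightarrow 1 = 0$ in $A$. The ring $A$ is not assumed to be nontrivial, discrete (decidable equality), or strongly discrete (decidable membership in finitely generated ideals). For an arbitrary (not necessarily detachable) subset $M \subseteq A$, $(M)$ denotes the ideal generated by $M$, i.e. $(M) = \{\sum_{i=1}^k a_i v_i \mid k \geq 0,\ a_i \in A,\ v_i \in M\}$, and $(x) = (\{x\})$. The set $\{x_n \mid 1 \notin \mathfrak{m}_n + (x_n)\}$ is the subset of the singleton $\{x_n\}$ which contains $x_n$ if and only if $1 \notin \mathfrak{m}_n + (x_n)$. That $\mathfrak{m}$ is an ideal is because it is a directed union of ideals. *)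

(* Defs.v *)
From Stdlib Require Import NArith.
From Stdlib Require Export List Cring.

(* The carrier is a setoid (equality [==]), and subsets are Prop-valued
   predicates, so neither equality nor membership is decidable.  The class
   [Cring] does not exclude the trivial ring. *)

Definition subset_compat {A : Type} `{Rc : Cring A} (M : A -> Prop) : Prop :=
  forall x y, x == y -> M x -> M y.

Record ideal (A : Type) `{Rc : Cring A} : Type := Ideal {
  mem :> A -> Prop;
  mem_compat : subset_compat mem;
  mem_0 : mem 0;
  mem_add : forall x y, mem x -> mem y -> mem (x + y);
  mem_mul : forall a x, mem x -> mem (a * x)
}.

Arguments ideal A {_ _ _ _ _ _ _ _ _ _}.
Arguments Ideal {A _ _ _ _ _ _ _ _ _ _}.
Arguments mem {A _ _ _ _ _ _ _ _ _ _}.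
Arguments mem_compat {A _ _ _ _ _ _ _ _ _ _}.
Arguments mem_0 {A _ _ _ _ _ _ _ _ _ _}.
Arguments mem_add {A _ _ _ _ _ _ _ _ _ _}.
Arguments mem_mul {A _ _ _ _ _ _ _ _ _ _}.

Definition zero_ideal {A : Type} `{Rc : Cring A} : ideal A.
Proof.
  refine (Ideal (fun x => x == 0) _ _ _ _).
  - intros x y e h. rewrite <- e. exact h.
  - reflexivity.
  - intros x y hx hy. rewrite hx, hy. cring.
  - intros a x hx. rewrite hx. cring.
Defined.

Definition ideal_add {A : Type} `{Rc : Cring A} (I J : ideal A) : ideal A.
Proof.
  refine (Ideal (fun x => exists u v, I u /\ J v /\ x == u + v) _ _ _ _).
  - intros x y e (u & v & hu & hv & h). exists u, v.
    repeat split; try assumption. rewrite <- e. exact h.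
  - exists 0, 0. repeat split; try apply mem_0. cring.
  - intros x y (u & v & hu & hv & h) (u' & v' & hu' & hv' & h').
    exists (u + u'), (v + v'). repeat split; try (apply mem_add; assumption).
    rewrite h, h'. cring.
  - intros a x (u & v & hu & hv & h). exists (a * u), (a * v).
    repeat split; try (apply mem_mul; assumption). rewrite h. cring.
Defined.

(* The list [(a_1, v_1) :: ... :: (a_k, v_k) :: nil] stands for
   a_1 v_1 + ... + a_k v_k. *)
Fixpoint lin_comb {A : Type} `{Rc : Cring A} (s : list (A * A)%type) : A :=
  match s with
  | nil => 0
  | (a, v) :: s' => a * v + lin_comb s'
  end.

Lemma lin_comb_app {A : Type} `{Rc : Cring A} (s t : list (A * A)%type) :
  lin_comb (s ++ t) == lin_comb s + lin_comb t.
Proof.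
  induction s as [|(b, v) s IH]; simpl.
  - cring.
  - rewrite IH. cring.
Qed.

Lemma lin_comb_scale {A : Type} `{Rc : Cring A} (a : A)
    (s : list (A * A)%type) :
  lin_comb (map (fun p => (a * fst p, snd p)) s) == a * lin_comb s.
Proof.
  induction s as [|(b, v) s IH]; simpl.
  - cring.
  - rewrite IH. cring.
Qed.

Definition gen {A : Type} `{Rc : Cring A} (M : A -> Prop) : ideal A.
Proof.
  refine (Ideal (fun x => exists s : list (A * A)%type,
    Forall (fun p => M (snd p)) s /\ x == lin_comb s) _ _ _ _).
  - intros x y e (s & hs & h). exists s. split; [exact hs|].
    rewrite <- e. exact h.
  - exists nil. split; [constructor | reflexivity].
  - intros x y (s & hs & h) (t & ht & h'). exists (s ++ t). split.
    + apply Forall_app. split; assumption.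
    + rewrite h, h', lin_comb_app. reflexivity.
  - intros a x (s & hs & h).
    exists (map (fun p => (a * fst p, snd p)) s). split.
    + apply Forall_map. exact hs.
    + rewrite h, lin_comb_scale. reflexivity.
Defined.

Definition principal {A : Type} `{Rc : Cring A} (x : A) : ideal A :=
  gen (fun y => y == x).

Lemma chain_le {A : Type} `{Rc : Cring A} (I : nat -> ideal A)
    (incr : forall n x, I n x -> I (S n) x) (n k : nat) (x : A) :
  I n x -> I (Nat.add k n) x.
Proof.
  intro h. induction k as [|k IH]; simpl; [exact h | apply incr, IH].
Qed.

Definition chain_union {A : Type} `{Rc : Cring A} (I : nat -> ideal A)
    (incr : forall n x, I n x -> I (S n) x) : ideal A.
Proof.
  refine (Ideal (fun x => exists n, I n x) _ _ _ _).
  - intros x y e (n & h). exists n. exact (mem_compat (I n) _ _ e h).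
  - exists O. apply mem_0.
  - intros x y (n & hx) (k & hy). exists (Nat.add k n). apply mem_add.
    + apply chain_le; assumption.
    + rewrite PeanoNat.Nat.add_comm. apply chain_le; assumption.
  - intros a x (n & h). exists n. apply mem_mul, h.
Defined.

(* Falsity is read as [1 == 0], not as [False]. *)
Definition notin {A : Type} `{Rc : Cring A} (I : ideal A) (x : A) : Prop :=
  I x -> 1 == 0.

Definition surjective_enum {A : Type} `{Rc : Cring A} (x : nat -> A) : Prop :=
  forall a, exists n, x n == a.

Fixpoint m_ {A : Type} `{Rc : Cring A} (x : nat -> A) (n : nat) : ideal A :=
  match n with
  | O => zero_ideal
  | S n' =>
      ideal_add (m_ x n')
        (gen (fun y =>
           y == x n' /\ notin (ideal_add (m_ x n') (principal (x n'))) 1))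
  end.

Lemma m_incr {A : Type} `{Rc : Cring A} (x : nat -> A) (n : nat) (a : A) :
  m_ x n a -> m_ x (S n) a.
Proof.
  intro h. exists a, 0. repeat split; [exact h | apply mem_0 | cring].
Qed.

Definition m {A : Type} `{Rc : Cring A} (x : nat -> A) : ideal A :=
  chain_union (m_ x) (m_incr x).

Definition proper {A : Type} `{Rc : Cring A} (I : ideal A) : Prop :=
  notin I 1.

Definition maximal {A : Type} `{Rc : Cring A} (I : ideal A) : Prop :=
  proper I /\ forall x, notin (ideal_add I (principal x)) 1 -> I x.

Definition prime {A : Type} `{Rc : Cring A} (I : ideal A) : Prop :=
  proper I /\ forall x y, I (x * y) -> notin I x -> I y.

Definition radical {A : Type} `{Rc : Cring A} (I : ideal A) : Prop :=
  forall (k : nat) (x : A), I (pow_N x (N.of_nat k)) -> I x.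

(* Main.v *)
(** If [1 = u + a x] with [u] in an ideal [I], then [x y] in [I] forces [y] in
    [I]: multiply by [y].  So if [I] is maximal, [x y] is in [I] and [x] is not,
    then [1] in [I + (y)] would put [x] in [I]; and if [x^k] is in [I], then
    [1] in [I + (x)] would put [1] in [I], by descent on [k].  In both cases
    maximality applies. *)
From Stdlib Require Import NArith.
Require Import Defs.

Section Ideals.
Context {A : Type} `{Rc : Cring A}.

Lemma gen_mem (M : A -> Prop) (y : A) : M y -> gen M y.
Proof.
  intro h. exists ((1, y) :: nil). split.
  - constructor; [exact h | constructor].
  - simpl. cring.
Qed.

Lemma gen_subset (M : A -> Prop) (I : ideal A) :
  (forall y, M y -> I y) -> forall z, gen M z -> I z.
Proof.
  intros hM z (s & hs & e).
  apply (mem_compat I (lin_comb s)); [symmetry; exact e | clear z e].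
  induction hs as [|(a, v) s hv hs IH]; simpl.
  - apply mem_0.
  - apply mem_add; [apply mem_mul, hM, hv | exact IH].
Qed.

(** All generators in the combination equal [x], so its coefficients add up to one. *)
Lemma principal_multiple (x z : A) : principal x z -> exists a, z == a * x.
Proof.
  intros (s & hs & e).
  enough (h : exists a, lin_comb s == a * x).
  { destruct h as (a & h). exists a. rewrite e. exact h. }
  clear z e. induction hs as [|(b, v) s hv hs (a & IH)]; simpl in *.
  - exists 0. cring.
  - exists (b + a). rewrite IH, hv. cring.
Qed.

Lemma ideal_add_subset (I I' J J' : ideal A) :
  (forall z, I z -> I' z) -> (forall z, J z -> J' z) ->
  forall z, ideal_add I J z -> ideal_add I' J' z.
Proof.
  intros hI hJ z (u & v & hu & hv & e).
  exists u, v. repeat split; auto.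
Qed.

Lemma ideal_add_r (I J : ideal A) (z : A) : J z -> ideal_add I J z.
Proof.
  intro h. exists 0, z. repeat split; [apply mem_0 | exact h | cring].
Qed.

Lemma coprime_cancel (I : ideal A) (x y : A) :
  ideal_add I (principal x) 1 -> I (x * y) -> I y.
Proof.
  intros (u & v & hu & hv & e) hxy.
  destruct (principal_multiple _ _ hv) as (a & ev).
  apply (mem_compat I (y * u + a * (x * y))).
  - transitivity (y * (u + a * x)); [cring|].
    rewrite <- ev, <- e. cring.
  - apply mem_add; apply mem_mul; assumption.
Qed.

Lemma coprime_pow (I : ideal A) (x : A) (k : nat) :
  ideal_add I (principal x) 1 -> I (pow_N x (N.of_nat k)) -> I 1.
Proof.
  intro h1. induction k as [|k IH]; [intro h; exact h | intro h].
  apply IH, (coprime_cancel I x); [exact h1|].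
  refine (mem_compat I _ _ _ h).
  (* [pow_N] treats exponent [0] apart, so [x^1 = x * 1] needs its own case. *)
  destruct k as [|k]; simpl.
  - cring.
  - apply pow_pos_succ.
Qed.

Lemma maximal_prime (I : ideal A) : maximal I -> prime I.
Proof.
  intros (hp & hm). split; [exact hp|].
  intros x y hxy hx. apply hm. intro h1. apply hx.
  apply (coprime_cancel I y); [exact h1|].
  apply (mem_compat I (x * y)); [cring | exact hxy].
Qed.

Lemma maximal_radical (I : ideal A) : maximal I -> radical I.
Proof.
  intros (hp & hm) k x hk. apply hm. intro h1.
  apply hp, (coprime_pow I x k); assumption.
Qed.

(* Adjoining [x n] means generating by an undecided subsingleton, but a linear
   combination is a list: if empty, it is [0]; if not, it carries a proof that
   [1] is not in [m_n + (x n)]. *)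
Lemma m_step_proper (x : nat -> A) (n : nat) :
  proper (m_ x n) -> proper (m_ x (S n)).
Proof.
  intros IH (u & v & hu & (s & hs & ev) & e).
  destruct hs as [|p s (hp & hn) hs].
  - apply IH, (mem_compat _ u); [|exact hu].
    rewrite e, ev. simpl. cring.
  (* Every generator used equals [x n], so the same [u + v] puts [1] in [m_n + (x n)]. *)
  - apply hn. exists u, v. repeat split; [exact hu | | exact e].
    exists (p :: s). split; [|exact ev].
    constructor; [exact hp|].
    apply (Forall_impl _ (fun q h => proj1 h) hs).
Qed.

Lemma m_proper (x : nat -> A) : proper (m x).
Proof.
  intros (n & h). revert h. change (proper (m_ x n)).
  induction n as [|n IH].
  (* Membership of [1] in the zero ideal is [1 == 0], which is falsity itself. *)
  - intro h. exact h.
  - apply m_step_proper, IH.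
Qed.

(** Write [y] as [x n]. Since [m_n] lies in [m], [1] is not in [m_n + (x n)] either, so [x n] is
    adjoined at stage [S n]. *)
Lemma m_maximal (x : nat -> A) : surjective_enum x -> maximal (m x).
Proof.
  intro x_surj. split; [apply m_proper|].
  intros y hy. destruct (x_surj y) as (n & e).
  apply (mem_compat _ (x n)); [exact e|].
  exists (S n). apply ideal_add_r, gen_mem. split; [reflexivity|].
  intro h. apply hy. revert h. apply ideal_add_subset.
  - intros z hz. exists n. exact hz.
  - apply gen_subset. intros z hz. apply gen_mem.
    rewrite hz. exact e.
Qed.

End Ideals.

Theorem corollary1p2 (A : Type) `{Rc : Cring A} (x : nat -> A)
    (x_surj : surjective_enum x) :
  maximal (m x) /\ prime (m x) /\ radical (m x).
Proof.
  pose proof (m_maximal x x_surj) as h.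
  split; [exact h | split].
  - apply maximal_prime, h.
  - apply maximal_radical, h.
Qed.
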